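(* Let $(M^{2n+1},\varphi,\xi,\eta,g)$ be a trans-para-Sasakian manifold of type $(\alpha,\beta)$ such that $\varphi(\mathrm{grad}\,\alpha)=-(2n-1)\,\mathrm{grad}\,\beta$, and let $a,b$ be nonzero real constants. If $M$ is pseudo-projectively flat, i.e. $\overline{P}=0$ for the pseudo-projective curvature tensor $\overline{P}$ with constants $a,b$, then $M$ is an Einstein manifold and its scalar curvature is $\mathrm{scal}=-2n(2n+1)(\alpha^2+\beta^2)$.
   Context: Let $n\ge 1$ and let $M$ be a smooth manifold of dimension $2n+1$. An almost paracontact metric structure $(\varphi,\xi,\eta,g)$ on $M$ consists of a $(1,1)$-tensor field $\varphi$, a vector field $\xi$, a 1-form $\eta$ and a pseudo-Riemannian metric $g$ with $\varphi\xi=0$, $\eta\circ\varphi=0$, $\eta(\xi)=1$, $\varphi^2=\mathrm{id}-\eta\otimes\xi$, $g(\varphi X,\varphi Y)=-g(X,Y)+\eta(X)\eta(Y)$, such that $\varphi$ induces an almost paracomplex structure on $\ker\eta$ (its $\pm1$-eigendistributions there have equal rank $n$). Then $\eta(X)=g(X,\xi)$ and $g$ has signature $(n+1,n)$. Let $\nabla$ be the Levi-Civita connection of $g$. The manifold is called trans-para-Sasakian of type $(\alpha,\beta)$, where $\alpha,\beta$ are smooth functions on $M$, if for all vector fields $X,Y$ $$(\nabla_X\varphi)Y=\alpha(-g(X,Y)\xi+\eta(Y)X)+\beta(g(X,\varphi Y)\xi+\eta(Y)\varphi X).$$ Curvature: $R(X,Y)Z=\nabla_X\nabla_YZ-\nabla_Y\nabla_XZ-\nabla_{[X,Y]}Z$;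 $\mathrm{Ric}(Y,Z)$ is the trace of $X\mapsto R(X,Y)Z$; $\mathrm{scal}$ is the $g$-trace of $\mathrm{Ric}$; gradients are taken with respect to $g$. The pseudo-projective curvature tensor (with constants $a,b\ne 0$) is $$\overline{P}(X,Y)Z=aR(X,Y)Z+b\left(\mathrm{Ric}(Y,Z)X-\mathrm{Ric}(X,Z)Y\right)-\frac{(a+2nb)\,\mathrm{scal}}{2n(2n+1)}\left(g(Y,Z)X-g(X,Z)Y\right).$$ $M$ is Einstein if $\mathrm{Ric}=\lambda g$ for some function $\lambda$ (automatically locally constant since $\dim M\ge 3$). *)

(* Defs.v *)
From HB Require Import structures.
From mathcomp Require Import all_boot all_order all_algebra.
From mathcomp Require Import all_classical all_reals all_analysis.

Set Implicit Arguments.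
Unset Strict Implicit.
Unset Printing Implicit Defensive.

Import Order.TTheory GRing.Theory Num.Theory numFieldNormedType.Exports.
Local Open Scope classical_set_scope.
Local Open Scope ring_scope.

(** * Smooth maps on open subsets of R^m

    R^m is ['rV[R]_m], so linear maps act on the right of row vectors. *)

Definition coord_vec {R : realType} {m : nat} (i : 'I_m) : 'rV[R]_m :=
  delta_mx 0 i.

Fixpoint iter_partial {R : realType} {m : nat} {W : normedModType R}
    (s : seq 'I_m) (f : 'rV[R]_m -> W) : 'rV[R]_m -> W :=
  if s is i :: s' then fun x => 'D_(coord_vec i) (iter_partial s' f) x else f.

Definition smooth_on {R : realType} {m : nat} {W : normedModType R}
    (V : set 'rV[R]_m) (f : 'rV[R]_m -> W) : Prop :=
  forall (s : seq 'I_m) (x : 'rV[R]_m), V x ->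
    {for x, continuous (iter_partial s f)} /\
    (forall i : 'I_m, derivable (iter_partial s f) x (coord_vec i)).

(** * Smooth manifolds *)

(** [chart_inv] is total, but only its values on [chart_map @` chart_dom]
    are meaningful. *)
Record chart (R : realType) (m : nat) (T : topologicalType) := Chart {
  chart_dom : set T;
  chart_map : T -> 'rV[R]_m;
  chart_inv : 'rV[R]_m -> T;
  chart_dom_open : open chart_dom;
  chart_img_open : open (chart_map @` chart_dom);
  chart_mapK : forall p, chart_dom p -> chart_inv (chart_map p) = p;
  chart_map_continuous :
    forall p, chart_dom p -> {for p, continuous chart_map};
  chart_inv_continuous :
    forall x, (chart_map @` chart_dom) x -> {for x, continuous chart_inv}
}.

Definition chart_img {R : realType} {m : nat} {T : topologicalType}
    (c : chart R m T) : set 'rV[R]_m := chart_map c @` chart_dom c.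

Definition overlap {R : realType} {m : nat} {T : topologicalType}
    (c d : chart R m T) : set 'rV[R]_m :=
  chart_map c @` (chart_dom c `&` chart_dom d).

Definition transition {R : realType} {m : nat} {T : topologicalType}
    (c d : chart R m T) : 'rV[R]_m -> 'rV[R]_m :=
  fun x => chart_map d (chart_inv c x).

Record manifold (R : realType) (m : nat) := Manifold {
  points :> topologicalType;
  atlas_index : Type;
  atlas : atlas_index -> chart R m points;
  manifold_hausdorff : hausdorff_space points;
  manifold_second_countable : @second_countable points;
  atlas_cover : forall p : points, exists c, chart_dom (atlas c) p;
  atlas_compatible : forall c d,
    smooth_on (overlap (atlas c) (atlas d)) (transition (atlas c) (atlas d))
}.

Definition img {R : realType} {m : nat} (M : manifold R m)
  (c : atlas_index M) : set 'rV[R]_m := chart_img (atlas c).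

Definition point_of {R : realType} {m : nat} (M : manifold R m)
  (c : atlas_index M) : 'rV[R]_m -> M := chart_inv (atlas c).

Definition chg_overlap {R : realType} {m : nat} (M : manifold R m)
  (c d : atlas_index M) : set 'rV[R]_m := overlap (atlas c) (atlas d).

Definition chg {R : realType} {m : nat} (M : manifold R m)
  (c d : atlas_index M) : 'rV[R]_m -> 'rV[R]_m := transition (atlas c) (atlas d).

Definition smooth_function {R : realType} {m : nat} (M : manifold R m)
    (f : M -> R) : Prop :=
  forall c : atlas_index M, smooth_on (img c) (fun x => f (point_of c x) : R^o).

(** * Tensor fields on a manifold

    A tensor field is its family of component matrices in the charts, subject
    to the change of coordinates law; the differential of the change of
    coordinates is [u |-> 'D_u (chg c d) x]. *)

(** [eval_form w v] is w(v), [eval_bilin G u v] is G(u, v); an endomorphism A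
    sends v to [v *m A]. *)
Definition eval_form {R : realType} {m : nat} (w : 'cV[R]_m)
  (v : 'rV[R]_m) : R := (v *m w) 0 0.

Definition eval_bilin {R : realType} {m : nat} (G : 'M[R]_m)
  (u v : 'rV[R]_m) : R := (u *m G *m v^T) 0 0.

Record vector_field (R : realType) (m : nat) (M : manifold R m) := VectorField {
  vf_comp :> atlas_index M -> 'rV[R]_m -> 'rV[R]_m;
  vf_smooth : forall c, smooth_on (img c) (vf_comp c);
  vf_change : forall c d x, chg_overlap c d x ->
    vf_comp d (chg c d x) = 'D_(vf_comp c x) (chg c d) x
}.

Record one_form (R : realType) (m : nat) (M : manifold R m) := OneForm {
  form_comp :> atlas_index M -> 'rV[R]_m -> 'cV[R]_m;
  form_smooth : forall c, smooth_on (img c) (form_comp c);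
  form_change : forall c d x, chg_overlap c d x -> forall v : 'rV[R]_m,
    eval_form (form_comp d (chg c d x)) ('D_v (chg c d) x)
      = eval_form (form_comp c x) v
}.

Record endo_field (R : realType) (m : nat) (M : manifold R m) := EndoField {
  endo_comp :> atlas_index M -> 'rV[R]_m -> 'M[R]_m;
  endo_smooth : forall c, smooth_on (img c) (endo_comp c);
  endo_change : forall c d x, chg_overlap c d x -> forall v : 'rV[R]_m,
    'D_v (chg c d) x *m endo_comp d (chg c d x)
      = 'D_(v *m endo_comp c x) (chg c d) x
}.

Record pseudo_metric (R : realType) (m : nat) (M : manifold R m) :=
  PseudoMetric {
  metric_comp :> atlas_index M -> 'rV[R]_m -> 'M[R]_m;
  metric_smooth : forall c, smooth_on (img c) (metric_comp c);
  metric_change : forall c d x, chg_overlap c d x -> forall u v : 'rV[R]_m,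
    eval_bilin (metric_comp d (chg c d x))
      ('D_u (chg c d) x) ('D_v (chg c d) x)
      = eval_bilin (metric_comp c x) u v;
  metric_sym : forall c x, img c x -> (metric_comp c x)^T = metric_comp c x;
  metric_nondegenerate : forall c x, img c x -> metric_comp c x \in unitmx
}.

(** * Vector fields on coordinate domains

    All identities below are local and tensorial, so the vector fields X, Y, Z
    occurring in them range over the smooth vector fields on the domain of an
    arbitrary chart c, written in the coordinates of c, i.e. over the smooth
    maps from [img c] to R^m. *)

Definition local_field (R : realType) (m : nat) := 'rV[R]_m -> 'rV[R]_m.

Definition bracket {R : realType} {m : nat} (X Y : local_field R m) :
  local_field R m := fun x => 'D_(X x) Y x - 'D_(Y x) X x.

Definition apply_endo {R : realType} {m : nat} (A : 'rV[R]_m -> 'M[R]_m)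
  (X : local_field R m) : local_field R m := fun x => X x *m A x.

(** Two fields, on the domains of c and d, which agree on the intersection. *)
Definition agree {R : realType} {m : nat} (M : manifold R m)
    (c d : atlas_index M) (X X' : local_field R m) : Prop :=
  forall x, chg_overlap c d x -> X' (chg c d x) = 'D_(X x) (chg c d) x.

Definition connection {R : realType} {m : nat} (M : manifold R m) :=
  atlas_index M -> local_field R m -> local_field R m -> local_field R m.

Record is_affine_connection {R : realType} {m : nat} (M : manifold R m)
    (nabla : connection M) : Prop := IsAffineConnection {
  nabla_smooth : forall c X Y,
    smooth_on (img c) X -> smooth_on (img c) Y ->
    smooth_on (img c) (nabla c X Y);
  nabla_linear_l : forall c (f : 'rV[R]_m -> R^o) X X' Y,
    smooth_on (img c) f -> smooth_on (img c) X -> smooth_on (img c) X' ->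
    smooth_on (img c) Y -> forall x, img c x ->
    nabla c (fun y => f y *: X y + X' y) Y x
      = f x *: nabla c X Y x + nabla c X' Y x;
  nabla_additive_r : forall c X Y Y',
    smooth_on (img c) X -> smooth_on (img c) Y -> smooth_on (img c) Y' ->
    forall x, img c x ->
    nabla c X (fun y => Y y + Y' y) x = nabla c X Y x + nabla c X Y' x;
  nabla_leibniz : forall c (f : 'rV[R]_m -> R^o) X Y,
    smooth_on (img c) f -> smooth_on (img c) X -> smooth_on (img c) Y ->
    forall x, img c x ->
    nabla c X (fun y => f y *: Y y) x
      = 'D_(X x) f x *: Y x + f x *: nabla c X Y x;
  nabla_change : forall c d X Y X' Y',
    smooth_on (img c) X -> smooth_on (img c) Y ->
    smooth_on (img d) X' -> smooth_on (img d) Y' ->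
    agree c d X X' -> agree c d Y Y' ->
    agree c d (nabla c X Y) (nabla d X' Y')
}.

Record is_levi_civita {R : realType} {m : nat} (M : manifold R m)
    (g : pseudo_metric M) (nabla : connection M) : Prop := IsLeviCivita {
  lc_affine : is_affine_connection nabla;
  lc_torsion_free : forall c X Y,
    smooth_on (img c) X -> smooth_on (img c) Y -> forall x, img c x ->
    nabla c X Y x - nabla c Y X x = bracket X Y x;
  lc_metric : forall c X Y Z,
    smooth_on (img c) X -> smooth_on (img c) Y -> smooth_on (img c) Z ->
    forall x, img c x ->
    'D_(X x) (fun y => eval_bilin (g c y) (Y y) (Z y) : R^o) x
      = eval_bilin (g c x) (nabla c X Y x) (Z x)
        + eval_bilin (g c x) (Y x) (nabla c X Z x)
}.

(** * Curvature and gradient *)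

Definition curv {R : realType} {m : nat} (M : manifold R m)
    (nabla : connection M) (c : atlas_index M) (X Y Z : local_field R m) :
    local_field R m := fun x =>
  nabla c X (nabla c Y Z) x - nabla c Y (nabla c X Z) x
  - nabla c (bracket X Y) Z x.

Definition coord_field {R : realType} {m : nat} (i : 'I_m) : local_field R m :=
  fun _ => coord_vec i.

(** The i-th row of the matrix is the image of the i-th coordinate field under
    X |-> R(X, Y)Z. *)
Definition ric {R : realType} {m : nat} (M : manifold R m)
    (nabla : connection M) (c : atlas_index M) (Y Z : local_field R m)
    (x : 'rV[R]_m) : R :=
  \tr (\matrix_(i < m, j < m) curv nabla c (coord_field i) Y Z x 0 j).

Definition scal {R : realType} {m : nat} (M : manifold R m)
    (g : pseudo_metric M) (nabla : connection M) (c : atlas_index M)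
    (x : 'rV[R]_m) : R :=
  \sum_(i < m) \sum_(j < m)
    invmx (g c x) i j * ric nabla c (coord_field i) (coord_field j) x.

(** The vector with g(grad f, v) = df(v) for all v. *)
Definition grad {R : realType} {m : nat} (M : manifold R m)
    (g : pseudo_metric M) (f : M -> R) (c : atlas_index M) :
    local_field R m := fun x =>
  (\row_(i < m) 'D_(coord_vec i) (fun y => f (point_of c y) : R^o) x)
    *m invmx (g c x).

Definition is_einstein {R : realType} {m : nat} (M : manifold R m)
    (g : pseudo_metric M) (nabla : connection M) : Prop :=
  exists lambda : M -> R, forall (c : atlas_index M) (Y Z : local_field R m),
    smooth_on (img c) Y -> smooth_on (img c) Z -> forall x, img c x ->
    ric nabla c Y Z x
      = lambda (point_of c x) * eval_bilin (g c x) (Y x) (Z x).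

(** * Almost paracontact metric structures, in dimension 2n+1 *)

Record is_almost_paracontact_metric {R : realType} {n : nat}
    (M : manifold R (2 * n).+1) (phi : endo_field M) (xi : vector_field M)
    (eta : one_form M) (g : pseudo_metric M) : Prop :=
  IsAlmostParacontactMetric {
  apm_phi_xi : forall c x, img c x -> xi c x *m phi c x = 0;
  apm_eta_phi : forall c x, img c x -> forall v,
    eval_form (eta c x) (v *m phi c x) = 0;
  apm_eta_xi : forall c x, img c x -> eval_form (eta c x) (xi c x) = 1;
  apm_phi2 : forall c x, img c x -> forall v,
    v *m phi c x *m phi c x = v - eval_form (eta c x) v *: xi c x;
  apm_compatible : forall c x, img c x -> forall u v,
    eval_bilin (g c x) (u *m phi c x) (v *m phi c x)
      = - eval_bilin (g c x) u v
        + eval_form (eta c x) u * eval_form (eta c x) v;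
  apm_eigen_pos : forall c x, img c x ->
    \rank (eigenspace (phi c x) 1 :&: kermx (eta c x))%MS = n;
  apm_eigen_neg : forall c x, img c x ->
    \rank (eigenspace (phi c x) (-1) :&: kermx (eta c x))%MS = n
}.

Definition nabla_endo {R : realType} {m : nat} (M : manifold R m)
    (nabla : connection M) (phi : endo_field M) (c : atlas_index M)
    (X Y : local_field R m) : local_field R m := fun x =>
  nabla c X (apply_endo (phi c) Y) x - apply_endo (phi c) (nabla c X Y) x.

Definition is_trans_para_sasakian {R : realType} {n : nat}
    (M : manifold R (2 * n).+1) (phi : endo_field M) (xi : vector_field M)
    (eta : one_form M) (g : pseudo_metric M) (nabla : connection M)
    (alpha beta : M -> R) : Prop :=
  forall (c : atlas_index M) (X Y : local_field R (2 * n).+1),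
    smooth_on (img c) X -> smooth_on (img c) Y -> forall x, img c x ->
    nabla_endo nabla phi c X Y x
      = alpha (point_of c x) *:
          (- eval_bilin (g c x) (X x) (Y x) *: xi c x
           + eval_form (eta c x) (Y x) *: X x)
        + beta (point_of c x) *:
          (eval_bilin (g c x) (X x) (Y x *m phi c x) *: xi c x
           + eval_form (eta c x) (Y x) *: (X x *m phi c x)).

Definition pseudo_projective {R : realType} {n : nat}
    (M : manifold R (2 * n).+1) (g : pseudo_metric M) (nabla : connection M)
    (a b : R) (c : atlas_index M) (X Y Z : local_field R (2 * n).+1) :
    local_field R (2 * n).+1 := fun x =>
  a *: curv nabla c X Y Z x
  + b *: (ric nabla c Y Z x *: X x - ric nabla c X Z x *: Y x)
  - ((a + 2 * n%:R * b) * scal g nabla c x / (2 * n%:R * (2 * n%:R + 1))) *: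
      (eval_bilin (g c x) (Y x) (Z x) *: X x
       - eval_bilin (g c x) (X x) (Z x) *: Y x).

Definition pseudo_projectively_flat {R : realType} {n : nat}
    (M : manifold R (2 * n).+1) (g : pseudo_metric M) (nabla : connection M)
    (a b : R) : Prop :=
  forall (c : atlas_index M) (X Y Z : local_field R (2 * n).+1),
    smooth_on (img c) X -> smooth_on (img c) Y -> smooth_on (img c) Z ->
    forall x, img c x -> pseudo_projective g nabla a b c X Y Z x = 0.

(* Main.v *)
Require Import Defs.
From mathcomp Require Import all_boot all_order all_algebra.
From mathcomp Require Import all_classical all_reals all_analysis.
From mathcomp Require Import ring lra.
Import Order.TTheory GRing.Theory Num.Theory numFieldNormedType.Exports.
Local Open Scope classical_set_scope.
Local Open Scope ring_scope.

Set Implicit Arguments.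
Unset Strict Implicit.
Unset Printing Implicit Defensive.

(** Two independent arguments determine the curvature at each point.

    Flatness.  Pair the flatness identity for (X, Y, Z) with W, the one for
    (X, Y, W) with Z, and add.  Since each R(X, Y) is skew for g
    ([curv_skew]), both the R-term and the g-term cancel; as b <> 0, what is
    left is a relation between Ric and g that already forces Ric to be a
    multiple of g ([curvature_like_einstein]).  Taking no trace of the
    pseudo-projective tensor, this covers the value a + 2nb = 0 as well.
    Putting Ric back into the flatness identity and dividing by a gives
    R(X, Y)Z = K (g(Y, Z) X - g(X, Z) Y) at the point
    ([flat_constant_curvature]), whence Ric = 2n K g and
    scal = 2n (2n+1) K.

    The value of K.  Applying phi to the trans-para-Sasakian identity for
    (X, xi) gives
    nabla_X xi = - alpha phi X - beta (X - eta(X) xi)  ([nabla_xi]), and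
    differentiating once more one finds, modulo multiples of xi,
    R(v, xi)xi = (xi(alpha) - 2 alpha beta) phi v
                 + (xi(beta) - alpha^2 - beta^2) v   ([curv_xi_xi]).
    The gradient hypothesis gives xi(beta) = 0, because eta kills the image
    of phi.  For v in ker eta with phi v = e v, where e = 1 or e = -1, the
    left-hand side is K v; both eigenvalues occur, so the coefficient of
    phi v vanishes and K = - (alpha^2 + beta^2)
    ([constant_curvature_value]).  In particular K is the value of a function
    on the manifold, so 2n K is an Einstein function common to all charts.

    The skewness of R(X, Y) rests on [X, Y]f = X(Yf) - Y(Xf)
    ([bracket_derive]), hence on the symmetry of second derivatives
    ([derive_comm]) and on the formula D_v f = sum_i v_i D_i f
    ([smooth_is_derive]); both are proved from the mean value theorem on
    segments. *)

(** * Maps with continuous iterated partial derivatives *)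

Section Smooth.
Context {R : realType} {m : nat}.
Implicit Types (V : set 'rV[R]_m) (x v : 'rV[R]_m).

Definition has_partials {W : normedModType R} V (f : 'rV[R]_m -> W) : Prop :=
  forall x, V x -> {for x, continuous f} /\
    (forall i : 'I_m, derivable f x (coord_vec i)).

(** The finite-order form of [smooth_on]: iterated partial derivatives are
    built here from the innermost one, so that closure properties can be
    proved by induction on the order, with the function generalized. *)
Fixpoint smooth_upto (k : nat) {W : normedModType R} V (f : 'rV[R]_m -> W) :
    Prop :=
  has_partials V f /\
  (if k is k'.+1 then forall i, smooth_upto k' V ('D_(coord_vec i) f)
   else True).

Lemma iter_partial_rcons {W : normedModType R} (s : seq 'I_m) i
    (f : 'rV[R]_m -> W) :
  iter_partial (rcons s i) f = iter_partial s ('D_(coord_vec i) f).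
Proof. by elim: s => //= j s ->. Qed.

Lemma smooth_onP {W : normedModType R} V (f : 'rV[R]_m -> W) :
  smooth_on V f <-> forall k, smooth_upto k V f.
Proof.
split.
- move=> + k; elim: k f => [|k IH] f sf; split => //; first exact: (sf [::]).
  + exact: (sf [::]).
  + by move=> i; apply: IH => s; rewrite -iter_partial_rcons; apply: sf.
- move=> + s; elim/last_ind: s f => [|s i IH] f sf.
  + by move=> x; have [pf _] := sf 0%N; exact: pf.
  + rewrite iter_partial_rcons; apply: IH => k.
    by have [_] := sf k.+1; apply.
Qed.

Lemma smooth_upto_le k {W : normedModType R} V (f : 'rV[R]_m -> W) :
  smooth_upto k.+1 V f -> smooth_upto k V f.
Proof.
elim: k f => [|k IH] f [pf sf]; first by split.
by split => // i; apply: IH.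
Qed.

Lemma smooth_partial {W : normedModType R} V (f : 'rV[R]_m -> W) i :
  smooth_on V f -> smooth_on V ('D_(coord_vec i) f).
Proof.
by move=> /smooth_onP sf; apply/smooth_onP => k; have [_] := sf k.+1; apply.
Qed.

Lemma near_open V (P : 'rV[R]_m -> Prop) x : open V -> V x ->
  (forall y, V y -> P y) -> \forall y \near x, P y.
Proof.
move=> oV Vx PV; have : nbhs x V by apply: open_nbhs_nbhs.
by apply: filterS.
Qed.

Lemma smooth_upto_eq k {W : normedModType R} V (f g : 'rV[R]_m -> W) :
  open V -> {in V, f =1 g} -> smooth_upto k V f -> smooth_upto k V g.
Proof.
move=> oV.
have P0 (f' g' : 'rV[R]_m -> W) : {in V, f' =1 g'} -> has_partials V f' ->
    has_partials V g'.
  move=> fg Pf x Vx; have [cf df] := Pf x Vx.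
  have nfg : \near x, f' x = g' x.
    by apply: near_open oV Vx _ => y Vy; apply: fg; rewrite inE.
  split; last by move=> i; apply: near_eq_derivable (df i).
  have fgx : f' x = g' x by apply: fg; rewrite inE.
  rewrite /prop_for /continuous_at -fgx.
  exact: cvg_trans (near_eq_cvg nfg) cf.
elim: k f g => [|k IH] f g fg [pf sf]; split=> //; try exact: P0 pf.
move=> i; apply: (IH _ _ _ (sf i)) => x /set_mem Vx.
apply: near_eq_derive; apply: near_open oV Vx _ => y Vy.
by apply: fg; rewrite inE.
Qed.

Lemma smooth_eq {W : normedModType R} V (f g : 'rV[R]_m -> W) :
  open V -> {in V, f =1 g} -> smooth_on V f -> smooth_on V g.
Proof.
move=> oV fg /smooth_onP sf; apply/smooth_onP => k.
exact: smooth_upto_eq (sf k).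
Qed.

Lemma smooth_cst {W : normedModType R} V (w : W) :
  smooth_on V (fun=> w).
Proof.
apply/smooth_onP => k; elim: k w => [|k IH] w.
  split=> // x _; split; first exact: cst_continuous.
  by move=> i; apply: derivable_cst.
split.
  move=> x _; split; first exact: cst_continuous.
  by move=> i; apply: derivable_cst.
move=> i; have -> : 'D_(coord_vec i) (fun=> w) = (fun=> 0) :> ('rV[R]_m -> W).
  by apply/funext => x; exact: derive_cst.
exact: IH.
Qed.

Lemma smooth_upto_add k {W : normedModType R} V (f g : 'rV[R]_m -> W) :
  open V -> smooth_upto k V f -> smooth_upto k V g ->
  smooth_upto k V (fun x => f x + g x).
Proof.
move=> oV.
have P0 (f' g' : 'rV[R]_m -> W) : has_partials V f' -> has_partials V g' ->
    has_partials V (fun x => f' x + g' x).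
  move=> pf pg x Vx; have [cf df] := pf x Vx; have [cg dg] := pg x Vx.
  split; first exact: (cvgD cf cg).
  by move=> i; exact: derivableD.
elim: k f g => [|k IH] f g [pf sf] [pg sg]; split=> //; try exact: P0.
move=> i; apply: (@smooth_upto_eq _ _ _
  (fun x => 'D_(coord_vec i) f x + 'D_(coord_vec i) g x)) => //.
  move=> x /set_mem Vx; have [_ df] := pf x Vx; have [_ dg] := pg x Vx.
  by rewrite -deriveD.
exact: (IH _ _ (sf i) (sg i)).
Qed.

Lemma smooth_add {W : normedModType R} V (f g : 'rV[R]_m -> W) : open V ->
  smooth_on V f -> smooth_on V g -> smooth_on V (fun x => f x + g x).
Proof.
move=> oV /smooth_onP sf /smooth_onP sg; apply/smooth_onP => k.
exact: smooth_upto_add.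
Qed.

Lemma smooth_mul V (f g : 'rV[R]_m -> R^o) : open V ->
  smooth_on V f -> smooth_on V g -> smooth_on V (fun x => f x * g x : R^o).
Proof.
move=> oV /smooth_onP sf /smooth_onP sg; apply/smooth_onP => k.
have {sf sg}:= conj (sf k) (sg k).
have P0 (f' g' : 'rV[R]_m -> R^o) : has_partials V f' -> has_partials V g' ->
    has_partials V (fun x => f' x * g' x : R^o).
  move=> pf pg x Vx; have [cf df] := pf x Vx; have [cg dg] := pg x Vx.
  split; first exact: (cvgM cf cg).
  by move=> i; exact: derivableM.
elim: k f g => [|k IH] f g [sf sg].
  by split=> //; apply: P0; [case: sf | case: sg].
have [pf df] := sf; have [pg dg] := sg.
split; first exact: P0.
move=> i; apply: (@smooth_upto_eq _ _ _
  (fun x => f x * 'D_(coord_vec i) g x + g x * 'D_(coord_vec i) f x : R^o)) => //.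
  move=> x /set_mem Vx; have [_ dfx] := pf x Vx; have [_ dgx] := pg x Vx.
  exact/esym/(deriveM (dfx i) (dgx i)).
apply: (smooth_upto_add oV); apply: IH.
  by split; [exact: smooth_upto_le sf | exact: dg].
by split; [exact: smooth_upto_le sg | exact: df].
Qed.

Lemma continuous_mxP (p q : nat) (F : 'rV[R]_m -> 'M[R]_(p, q)) x :
  {for x, continuous F} <->
  forall i j, {for x, continuous (fun y => F y i j : R^o)}.
Proof.
split=> [cF i j|cF].
  exact: (@cvg_comp _ _ _ F (fun A : 'M[R]_(p, q) => A i j : R^o) _ _ _ cF
    (@coord_continuous _ _ _ i j (F x))).
apply/(@cvgrPdist_le _ _ _ (nbhs x)) => e e0.
have near_ij : \forall y \near x, forall ij : 'I_p * 'I_q,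
    `|F x ij.1 ij.2 - F y ij.1 ij.2| <= e.
  apply: (@filter_forall _ _
    (fun ij y => `|F x ij.1 ij.2 - F y ij.1 ij.2| <= e) (nbhs x)) => ij.
  exact: ((cvgrPdist_le _ _).1 (cF ij.1 ij.2)).
apply: filterS near_ij => y Fy.
rewrite /Num.Def.normr/= mx_normrE (bigmax_le _ (ltW e0))//= => ij _.
by rewrite !mxE.
Qed.

Lemma smooth_mxP (p q : nat) V (F : 'rV[R]_m -> 'M[R]_(p, q)) : open V ->
  smooth_on V F <-> forall i j, smooth_on V (fun x => F x i j : R^o).
Proof.
move=> oV.
have P0 (F' : 'rV[R]_m -> 'M[R]_(p, q)) : has_partials V F' <->
    forall i j, has_partials V (fun x => F' x i j : R^o).
  split=> [pF i j x Vx|pF x Vx].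
    have [/continuous_mxP cF dF] := pF x Vx; split => // k.
    by have /derivable_mxP := dF k; apply.
  split; first by apply/continuous_mxP => i j; case: (pF i j x Vx).
  by move=> k; apply/derivable_mxP => i j; case: (pF i j x Vx).
have key k (F' : 'rV[R]_m -> 'M[R]_(p, q)) : smooth_upto k V F' <->
    forall i j, smooth_upto k V (fun x => F' x i j : R^o).
  elim: k F' => [|k IH] F'.
    by split=> [[/P0 pF _] //|sF]; split=> //; apply/P0 => i j; case: (sF i j).
  have comp l i j : has_partials V F' -> {in V,
     (fun x => 'D_(coord_vec l) F' x i j) =1
      'D_(coord_vec l) (fun x => F' x i j : R^o)}.
    by move=> pF x /set_mem Vx; rewrite derive_mx ?mxE//; case: (pF x Vx).
  split=> [[pF sF] i j|sF].
    split; first by move/P0: pF.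
    move=> l; apply: (smooth_upto_eq oV (comp l i j pF)).
    by have /IH := sF l; apply.
  have pF : has_partials V F' by apply/P0 => i j; case: (sF i j).
  split=> // l; apply/IH => i j.
  apply: (smooth_upto_eq oV (fun x Vx => esym (comp l i j pF x Vx))).
  by have [_] := sF i j; apply.
split=> [/smooth_onP sF i j|sF].
  by apply/smooth_onP => k; apply: (key k F).1 => //; exact: sF.
apply/smooth_onP => k; apply/key => i j.
by have /smooth_onP := sF i j; apply.
Qed.
End Smooth.

(** * Directional derivatives and the symmetry of second derivatives *)

Section DirectionalDerivatives.
Context {R : realType} {U : normedModType R}.
Implicit Types (f : U -> R^o) (x p e u w : U).

Lemma is_derive_line f p e t : derivable f (p + t *: e) e ->
  is_derive t 1 (fun s : R => f (p + s *: e)) ('D_e f (p + t *: e)).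
Proof.
move=> df.
have quotE : (fun h : R => h^-1 *:
      (((fun s : R => f (p + s *: e)) \o shift t) (h *: 1) - f (p + t *: e)))
    = (fun h => h^-1 *: ((f \o shift (p + t *: e)) (h *: e) - f (p + t *: e))).
  apply/funext => h /=; congr (_ *: (f _ - _)).
  by rewrite [_%:A]mulr1 scalerDl addrCA.
by split; [rewrite /derivable quotE|rewrite /derive quotE].
Qed.

Lemma derivable_shift f w x e :
  derivable f (x + w) e -> derivable (fun y => f (y + w)) x e.
Proof.
by rewrite /derivable; under [in X in X -> _]eq_fun do rewrite /= addrA.
Qed.

Lemma derive_shift f w x e :
  'D_e (fun y => f (y + w)) x = 'D_e f (x + w).
Proof.
by rewrite /derive; under [in RHS]eq_fun do rewrite /= addrA.
Qed.

(** The sign of the step is left free, since the limits below run over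
    punctured neighbourhoods of 0. *)
Lemma MVT_line f p e (h : R) :
  (forall s : R, `|s| <= `|h| -> derivable f (p + s *: e) e) ->
  exists2 s : R, `|s| <= `|h| & f (p + h *: e) - f p = h * 'D_e f (p + s *: e).
Proof.
move=> df; pose F (s : R) := f (p + s *: e).
have isdF (s : R) : `|s| <= `|h| -> is_derive s 1 F ('D_e f (p + s *: e)).
  by move=> /df; apply: is_derive_line.
have F0 : F 0 = f p by rewrite /F scale0r addr0.
have contF (i : interval R) : {in i, forall s, `|s| <= `|h|} ->
    {within [set` i], continuous F}.
  move=> ih; apply: derivable_within_continuous => s /ih sh.
  by have [] := isdF s sh.
have [h0|/ltW h0] := leP 0 h.
- have sh (s : R) : s \in `[0, h] -> `|s| <= `|h|.
    by rewrite in_itv/= => /andP[s0 sh]; rewrite !ger0_norm.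
  have [||s /sh sh0] := @MVT_segment _ F (fun s => 'D_e f (p + s *: e)) _ _ h0.
  + by move=> s s0h; apply: isdF; apply: sh; exact: subset_itv_oo_cc s0h.
  + exact: contF.
  by rewrite F0 subr0 mulrC => Fh; exists s.
- have sh (s : R) : s \in `[h, 0] -> `|s| <= `|h|.
    by rewrite in_itv/= => /andP[sh s0]; rewrite !ler0_norm// lerN2.
  have [||s /sh sh0] := @MVT_segment _ F (fun s => 'D_e f (p + s *: e)) _ _ h0.
  + by move=> s s0h; apply: isdF; apply: sh; exact: subset_itv_oo_cc s0h.
  + exact: contF.
  rewrite F0 sub0r mulrN => Fh; exists s => //.
  by apply: oppr_inj; rewrite opprB Fh mulrC.
Qed.

(** Split the increment of f along h (u + c e) at the point x + h u.  The first
    part is the difference quotient along u; the second is, by the mean value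
    theorem, h c times a value of D_e f near x, and D_e f is continuous at
    x. *)
Lemma is_derive_add_dir f x u e (d c : R) :
  is_derive x u f d -> (\forall y \near x, derivable f y e) ->
  {for x, continuous ('D_e f)} ->
  is_derive x (u + c *: e) f (d + c * 'D_e f x).
Proof.
move=> [du <-] dfe ce.
suff lim_e : (fun h : R =>
      h^-1 *: (f (h *: u + x + (h * c) *: e) - f (h *: u + x)))
    @ 0^' --> (c * 'D_e f x : R^o).
  have lim : (fun h : R =>
        h^-1 *: ((f \o shift x) (h *: (u + c *: e)) - f x))
      @ 0^' --> ('D_u f x + c * 'D_e f x : R^o).
    apply: (cvg_trans _ (cvgD du lim_e)); apply: near_eq_cvg; near=> h.
    rewrite /= !fctE -scalerDr; congr (_ *: _).
    rewrite addrC addrA subrK; congr (f _ - _).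
    by rewrite scalerDr scalerA addrAC.
  by split; [apply/cvg_ex; exists ('D_u f x + c * 'D_e f x) | apply/cvg_lim].
apply/cvgrPdist_le => eps eps0.
pose C := `|c| + 1; have C0 : 0 < C by rewrite ltr_wpDl.
have /cvgrPdist_le/(_ (eps / C) (divr_gt0 eps0 C0)) ce' := ce.
have [r /= r0 rP] := (nbhs_normP _ _).1 (filterI dfe ce').
(* All points met by the mean value theorem lie within |h| L of x; the summand
   1 only makes L positive, as in C above. *)
pose L := `|u| + `|c| * `|e| + 1.
have L0 : 0 < L by rewrite ltr_wpDl// addr_ge0// mulr_ge0.
near=> h.
have h0 : h != 0 by near: h; exact: nbhs_dnbhs_neq.
have hr : `|h| * L < r.
  rewrite -ltr_pdivlMr//; near: h; apply: dnbhs0_lt; exact: divr_gt0.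
have inball (s : R) : `|s| <= `|h * c| ->
    ball_ Num.Def.normr x r (h *: u + x + s *: e).
  rewrite normrM => sh; rewrite /ball_/= addrAC opprD addrCA subrr addr0 normrN.
  apply: le_lt_trans hr; apply: le_trans (ler_normD _ _) _.
  rewrite !normrZ /L -addrA mulrDr lerD2l mulrDr mulr1.
  by rewrite ler_wpDr// mulrA ler_wpM2r.
have [|s sh ->] := @MVT_line f (h *: u + x) e (h * c).
  by move=> s /inball/rP[].
have [_ Ds] := rP _ (inball s sh).
rewrite /GRing.scale/= !mulrA mulVf// mul1r -mulrBr normrM.
apply: le_trans (ler_wpM2l (normr_ge0 c) Ds) _.
by rewrite mulrCA ger_pMr// ler_pdivrMr// mul1r lerDl.
Unshelve. all: by end_near. Qed.

(** Two applications of the mean value theorem: first along e1 to the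
    difference y |-> f (y + h e2) - f y, then along e2 to D_e1 f. *)
Lemma cvg_second_difference f x e1 e2 :
  (\forall y \near x, derivable f y e1) ->
  (\forall y \near x, derivable ('D_e1 f) y e2) ->
  {for x, continuous ('D_e2 ('D_e1 f))} ->
  (fun h : R => h^-1 ^+ 2 * (f (x + h *: e1 + h *: e2) - f (x + h *: e1)
     - f (x + h *: e2) + f x)) @ 0^' --> ('D_e2 ('D_e1 f) x : R^o).
Proof.
move=> df ddf cdd; apply/cvgrPdist_le => eps eps0.
have /cvgrPdist_le/(_ eps eps0) cdd' := cdd.
have [r /= r0 rP] := (nbhs_normP _ _).1 (filterI df (filterI ddf cdd')).
pose L := `|e1| + `|e2| + 1.
have L0 : 0 < L by rewrite ltr_wpDl// addr_ge0.
near=> h.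
have h0 : h != 0 by near: h; exact: nbhs_dnbhs_neq.
have hr : `|h| * L < r.
  rewrite -ltr_pdivlMr//; near: h; apply: dnbhs0_lt; exact: divr_gt0.
have inball (s t : R) : `|s| <= `|h| -> `|t| <= `|h| ->
    ball_ Num.Def.normr x r (x + s *: e1 + t *: e2).
  move=> sh th; rewrite /ball_/= -addrA opprD addNKr normrN.
  apply: le_lt_trans hr; apply: le_trans (ler_normD _ _) _.
  rewrite !normrZ /L !mulrDr mulr1 ler_wpDr// lerD// ler_wpM2r//.
have n0 : `|0 : R| <= `|h| by rewrite normr0.
have inball1 (s : R) : `|s| <= `|h| -> ball_ Num.Def.normr x r (x + s *: e1).
  by move=> sh; have := inball s 0 sh n0; rewrite scale0r addr0.
pose F y := f (y + h *: e2) - f y.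
have dF1 (s : R) : `|s| <= `|h| ->
    derivable (fun y => f (y + h *: e2)) (x + s *: e1) e1.
  move=> sh; apply: derivable_shift.
  by have [] := rP _ (inball s h sh (lexx _)).
have dF2 (s : R) : `|s| <= `|h| -> derivable f (x + s *: e1) e1.
  by move=> sh; have [] := rP _ (inball1 s sh).
have [|s sh Fs] := @MVT_line F x e1 h.
  by move=> s sh; apply: derivableB; [exact: dF1 | exact: dF2].
have -> : f (x + h *: e1 + h *: e2) - f (x + h *: e1) - f (x + h *: e2) + f x
    = F (x + h *: e1) - F x by rewrite /F opprD opprK addrA.
rewrite Fs.
have -> : 'D_e1 F (x + s *: e1) =
    'D_e1 f (x + s *: e1 + h *: e2) - 'D_e1 f (x + s *: e1).
  rewrite -(derive_shift f (h *: e2)).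
  exact: (deriveB (dF1 s sh) (dF2 s sh)).
have [|t th ->] := @MVT_line ('D_e1 f) (x + s *: e1) e2 h.
  by move=> t th; have [_ []] := rP _ (inball s t sh th).
have [_ [_]] := rP _ (inball s t sh th).
by rewrite mulrA -expr2 mulrA -exprMn mulVf// expr1n mul1r.
Unshelve. all: by end_near. Qed.

(** The second difference quotient is symmetric in e1 and e2, so its two
    limits agree. *)
Lemma derive_comm f x e1 e2 :
  (\forall y \near x, derivable f y e1) ->
  (\forall y \near x, derivable f y e2) ->
  (\forall y \near x, derivable ('D_e1 f) y e2) ->
  (\forall y \near x, derivable ('D_e2 f) y e1) ->
  {for x, continuous ('D_e2 ('D_e1 f))} ->
  {for x, continuous ('D_e1 ('D_e2 f))} ->
  'D_e1 ('D_e2 f) x = 'D_e2 ('D_e1 f) x.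
Proof.
move=> d1 d2 d12 d21 c12 c21.
have l12 := cvg_second_difference d1 d12 c12.
have l21 := cvg_second_difference d2 d21 c21.
have <- := cvg_lim (@norm_hausdorff _ _) l12.
apply/esym/cvg_lim; first exact: norm_hausdorff.
apply: (cvg_trans _ l21); apply: near_eq_cvg; apply: nearW => h.
by rewrite (addrAC x) (addrAC _ (- f (x + h *: e2))).
Qed.
End DirectionalDerivatives.

(** * Calculus of smooth functions and fields on an open set *)

Section SmoothCalculus.
Context {R : realType} {m : nat} (V : set 'rV[R]_m) (oV : open V).
Implicit Types (x v : 'rV[R]_m) (f : 'rV[R]_m -> R^o) (X Y : local_field R m).

Lemma smooth_has_partials {W : normedModType R} (F : 'rV[R]_m -> W) x :
  smooth_on V F -> V x -> {for x, continuous F} /\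
    (forall i : 'I_m, derivable F x (coord_vec i)).
Proof. by move=> sF; apply: (sF [::]). Qed.

(** Continuity of the partial derivatives allows adding the coordinate
    directions to v one at a time. *)
Lemma smooth_is_derive f x v : smooth_on V f -> V x ->
  is_derive x v f (\sum_i v 0 i * 'D_(coord_vec i) f x).
Proof.
move=> sf Vx.
have main (s : seq 'I_m) : is_derive x (\sum_(i <- s) v 0 i *: coord_vec i) f
    (\sum_(i <- s) v 0 i * 'D_(coord_vec i) f x).
  elim: s => [|i s IH]; first by rewrite !big_nil; exact: is_derive0.
  rewrite !big_cons addrC [X in is_derive _ _ _ X]addrC.
  apply: is_derive_add_dir => //.
  - by apply: near_open oV Vx _ => y Vy; have [_] := smooth_has_partials sf Vy.
  - by have [] := smooth_has_partials (smooth_partial i sf) Vx.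
by rewrite [X in is_derive _ X](row_sum_delta v); exact: main.
Qed.

Lemma smooth_derivable f x v : smooth_on V f -> V x -> derivable f x v.
Proof. by move=> sf Vx; have [] := smooth_is_derive v sf Vx. Qed.

Lemma smooth_deriveE f x v : smooth_on V f -> V x ->
  'D_v f x = \sum_i v 0 i * 'D_(coord_vec i) f x.
Proof. by move=> sf Vx; have [_] := smooth_is_derive v sf Vx. Qed.

Lemma smooth_coord (p q : nat) (F : 'rV[R]_m -> 'M[R]_(p, q)) i j :
  smooth_on V F -> smooth_on V (fun x => F x i j : R^o).
Proof. by move/(smooth_mxP _ oV); apply. Qed.

Lemma smooth_derivable_mx (p q : nat) (F : 'rV[R]_m -> 'M[R]_(p, q)) x v :
  smooth_on V F -> V x -> derivable F x v.
Proof.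
move=> sF Vx; apply/derivable_mxP => i j.
exact: (smooth_derivable (smooth_coord i j sF) Vx).
Qed.

Lemma derive_coord (p q : nat) (F : 'rV[R]_m -> 'M[R]_(p, q)) x v i j :
  smooth_on V F -> V x -> 'D_v F x i j = 'D_v (fun y => F y i j : R^o) x.
Proof.
by move=> sF Vx; rewrite derive_mx ?mxE//; apply: smooth_derivable_mx.
Qed.

Lemma smooth_sum (I : Type) (s : seq I) (F : I -> 'rV[R]_m -> R^o) :
  (forall i, smooth_on V (F i)) ->
  smooth_on V (fun x => \sum_(i <- s) F i x : R^o).
Proof.
move=> sF; elim: s => [|i s IH].
  under [X in smooth_on _ X]eq_fun do rewrite big_nil.
  exact: smooth_cst.
under [X in smooth_on _ X]eq_fun do rewrite big_cons.
exact: (smooth_add oV (sF i) IH).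
Qed.

Lemma smooth_mulmx (p q r : nat) (F : 'rV[R]_m -> 'M[R]_(p, q))
    (G : 'rV[R]_m -> 'M[R]_(q, r)) :
  smooth_on V F -> smooth_on V G -> smooth_on V (fun x => F x *m G x).
Proof.
move=> sF sG; apply/(smooth_mxP _ oV) => i j.
under [X in smooth_on _ X]eq_fun do rewrite mxE.
apply: smooth_sum => k.
exact: (smooth_mul oV (smooth_coord i k sF) (smooth_coord k j sG)).
Qed.

Lemma smooth_trmx (p q : nat) (F : 'rV[R]_m -> 'M[R]_(p, q)) :
  smooth_on V F -> smooth_on V (fun x => (F x)^T).
Proof.
move=> sF; apply/(smooth_mxP _ oV) => i j.
under [X in smooth_on _ X]eq_fun do rewrite mxE.
exact: smooth_coord.
Qed.

Lemma smooth_scale (p q : nat) f (F : 'rV[R]_m -> 'M[R]_(p, q)) :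
  smooth_on V f -> smooth_on V F -> smooth_on V (fun x => f x *: F x).
Proof.
move=> sf sF; apply/(smooth_mxP _ oV) => i j.
under [X in smooth_on _ X]eq_fun do rewrite mxE.
exact: (smooth_mul oV sf (smooth_coord i j sF)).
Qed.

Lemma smooth_bilin (G : 'rV[R]_m -> 'M[R]_m) X Y :
  smooth_on V G -> smooth_on V X -> smooth_on V Y ->
  smooth_on V (fun x => eval_bilin (G x) (X x) (Y x) : R^o).
Proof.
move=> sG sX sY; apply: (smooth_coord (F := fun x => X x *m G x *m (Y x)^T)).
by apply: smooth_mulmx; [exact: smooth_mulmx|exact: smooth_trmx].
Qed.

Lemma smooth_derive f X : smooth_on V f -> smooth_on V X ->
  smooth_on V (fun x => 'D_(X x) f x : R^o).
Proof.
move=> sf sX.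
apply: (@smooth_eq _ _ R^o V
    (fun x => \sum_i X x 0 i * 'D_(coord_vec i) f x : R^o)) => //.
  by move=> x /set_mem Vx; rewrite smooth_deriveE.
apply: smooth_sum => i.
exact: (smooth_mul oV (smooth_coord 0 i sX) (smooth_partial i sf)).
Qed.

Lemma smooth_bracket X Y : smooth_on V X -> smooth_on V Y ->
  smooth_on V (bracket X Y).
Proof.
move=> sX sY; apply/(smooth_mxP _ oV) => i j; rewrite {i}(ord1 i).
apply: (@smooth_eq _ _ R^o V (fun x => 'D_(X x) (fun y => Y y 0 j : R^o) x +
    (-1) * 'D_(Y x) (fun y => X y 0 j : R^o) x : R^o)) => //.
  by move=> x /set_mem Vx; rewrite !mxE mulN1r !derive_coord.
apply: smooth_add => //; last apply: (smooth_mul oV).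
- by apply: smooth_derive; [apply: smooth_coord|].
- exact: smooth_cst.
- by apply: smooth_derive; [apply: smooth_coord|].
Qed.

Lemma derive_derive f X x v : smooth_on V f -> smooth_on V X -> V x ->
  'D_v (fun y => 'D_(X y) f y : R^o) x =
  \sum_i (X x 0 i * (\sum_j v 0 j * 'D_(coord_vec j) ('D_(coord_vec i) f) x)
    + 'D_v X x 0 i * 'D_(coord_vec i) f x).
Proof.
move=> sf sX Vx.
have -> : 'D_v (fun y => 'D_(X y) f y : R^o) x =
    'D_v (\sum_i (fun y => X y 0 i * 'D_(coord_vec i) f y : R^o)) x.
  apply: near_eq_derive; apply: near_open oV Vx _ => y Vy.
  by rewrite smooth_deriveE// fct_sumE.
have dX i : derivable (fun y => X y 0 i : R^o) x v.
  exact: smooth_derivable (smooth_coord _ _ sX) Vx.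
have df i : derivable ('D_(coord_vec i) f) x v.
  exact: smooth_derivable (smooth_partial _ sf) Vx.
rewrite derive_sum; last by move=> i; exact: (derivableM (dX i) (df i)).
apply: eq_bigr => i _.
rewrite [LHS](deriveM (dX i) (df i)) (derive_coord _ _ _ sX)//; congr (_ + _).
  by rewrite (smooth_deriveE _ (smooth_partial i sf) Vx).
by rewrite mulrC.
Qed.

(** Expanding both sides in coordinates, the second derivatives of f cancel by
    symmetry and the first derivatives carry the components of [X, Y]. *)
Lemma bracket_derive f X Y x :
  smooth_on V f -> smooth_on V X -> smooth_on V Y -> V x ->
  'D_(X x) (fun y => 'D_(Y y) f y : R^o) x
    - 'D_(Y x) (fun y => 'D_(X y) f y : R^o) x = 'D_(bracket X Y x) f x.
Proof.
move=> sf sX sY Vx; rewrite !derive_derive// smooth_deriveE// !big_split/=.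
have sd k : \forall y \near x, derivable f y (coord_vec k).
  by apply: near_open oV Vx _ => y Vy; exact: smooth_derivable.
have sdd k l : \forall y \near x, derivable ('D_(coord_vec k) f) y (coord_vec l).
  apply: near_open oV Vx _ => y Vy.
  exact: smooth_derivable (smooth_partial _ sf) Vy.
have comm i j : 'D_(coord_vec j) ('D_(coord_vec i) f) x =
    'D_(coord_vec i) ('D_(coord_vec j) f) x.
  apply: (derive_comm (sd _) (sd _) (sdd _ _) (sdd _ _)).
    exact: (smooth_has_partials (smooth_partial i (smooth_partial j sf)) Vx).1.
  exact: (smooth_has_partials (smooth_partial j (smooth_partial i sf)) Vx).1.
have -> : \sum_i Y x 0 i *
      (\sum_j X x 0 j * 'D_(coord_vec j) ('D_(coord_vec i) f) x) =
    \sum_i X x 0 i *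
      (\sum_j Y x 0 j * 'D_(coord_vec j) ('D_(coord_vec i) f) x).
  under eq_bigr do rewrite mulr_sumr.
  under [RHS]eq_bigr do rewrite mulr_sumr.
  rewrite exchange_big; apply: eq_bigr => j _; apply: eq_bigr => i _.
  by rewrite comm mulrCA.
rewrite opprD addrACA subrr add0r -sumrB.
by apply: eq_bigr => i _; rewrite !mxE mulrBl.
Qed.
End SmoothCalculus.

(** * Linear algebra in a tangent space *)

Section Bilinear.
Context {R : realType} {m : nat}.
Implicit Types (G : 'M[R]_m) (w : 'cV[R]_m) (u v : 'rV[R]_m).

Lemma eval_bilinDl G u1 u2 v :
  eval_bilin G (u1 + u2) v = eval_bilin G u1 v + eval_bilin G u2 v.
Proof. by rewrite /eval_bilin !mulmxDl mxE. Qed.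

Lemma eval_bilinZl G k u v : eval_bilin G (k *: u) v = k * eval_bilin G u v.
Proof. by rewrite /eval_bilin -!scalemxAl mxE. Qed.

Lemma eval_bilinNl G u v : eval_bilin G (- u) v = - eval_bilin G u v.
Proof. by rewrite -scaleN1r eval_bilinZl mulN1r. Qed.

Lemma eval_bilinC G u v : G^T = G -> eval_bilin G u v = eval_bilin G v u.
Proof.
move=> GT; rewrite /eval_bilin -[in RHS]GT.
have -> : v *m G^T *m u^T = (u *m G *m v^T)^T.
  by rewrite !trmx_mul trmxK mulmxA.
by rewrite [RHS]mxE.
Qed.

Lemma eval_bilin0r G u : eval_bilin G u 0 = 0.
Proof. by rewrite /eval_bilin trmx0 mulmx0 mxE. Qed.

Lemma eval_bilin_coord G i j :
  eval_bilin G (coord_vec i) (coord_vec j) = G i j.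
Proof. by rewrite /eval_bilin -rowE trmx_delta -colE !mxE. Qed.

Lemma eval_bilin_sum G u v :
  \sum_i u 0 i * eval_bilin G (coord_vec i) v = eval_bilin G u v.
Proof.
rewrite {2}(row_sum_delta u) /eval_bilin !mulmx_suml summxE.
by apply: eq_bigr => i _; rewrite -!scalemxAl [RHS]mxE.
Qed.

Lemma nondegenerate_pairing G v : G \in unitmx -> v != 0 ->
  exists w : 'rV[R]_m, eval_bilin G v w = 1.
Proof.
move=> uG v0; have vG0 : v *m G != 0.
  by apply: contra_neq v0 => vG0; rewrite -(mulmxK uG v) vG0 mul0mx.
have /rV0Pn[j vGj] := vG0.
exists (((v *m G) 0 j)^-1 *: coord_vec j).
set k := (v *m G) 0 j in vGj *.
rewrite /eval_bilin linearZ/= -scalemxAr trmx_delta -colE 2!mxE -/k.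
by rewrite mulVf.
Qed.

Lemma eval_formZ w k u : eval_form w (k *: u) = k * eval_form w u.
Proof. by rewrite /eval_form -!scalemxAl mxE. Qed.
End Bilinear.

(** Here r is to be the Ricci tensor and h the metric at a point.  Both are
    mere functions on a type T, which stands for the fields defined on a whole
    chart: h depends only on the values at the point, while r involves
    derivatives.  Evaluating the relation at X = W = e shows that r differs from
    (r e e) h by s(Z) h(Y, e) for some function s; the relation at (v, e, Z, W)
    with v orthogonal to e becomes s(Z) h(v, W) + s(W) h(v, Z) = 0, and
    h(v, w) = 1 makes s vanish, first at w and then everywhere. *)
Lemma curvature_like_einstein (R : realFieldType) (T : Type)
    (r h : T -> T -> R) (e v w : T) :
  (forall X Y, h X Y = h Y X) -> h e e = 1 -> h v e = 0 -> h v w = 1 ->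
  (forall X Y Z W, r Y Z * h X W - r X Z * h Y W
     + (r Y W * h X Z - r X W * h Y Z) = 0) ->
  forall Y Z, r Y Z = r e e * h Y Z.
Proof.
move=> hC ee ve vw H.
have rYe Y : r Y e = r e e * h Y e.
  by have := H e Y e e; rewrite ee; lra.
pose s Z := r e Z - r e e * h e Z.
have rE Y Z : r Y Z = s Z * h Y e + r e e * h Y Z.
  have := H e Y Z e; rewrite ee rYe /s; lra.
have sE Z W : s Z * h v W + s W * h v Z = 0.
  have := H v e Z W; rewrite (rE v Z) (rE v W) ve /s; lra.
have sw : s w = 0 by have := sE w w; rewrite vw; lra.
have s0 Z : s Z = 0 by have := sE Z w; rewrite vw sw; lra.
by move=> Y Z; rewrite rE s0 mul0r add0r.
Qed.

(** The sum of the flatness identity for (X, Y, Z) paired with W and the one for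
    (X, Y, W) paired with Z, where s = g(R(X, Y)Z, W) and t = g(R(X, Y)W, Z):
    the C-terms cancel by themselves and the curvature terms by s + t = 0. *)
Lemma skew_ricci_relation (R : realFieldType)
    (a b C s t rYZ rXZ rYW rXW gXW gYW gXZ gYZ : R) : b != 0 ->
  s + t = 0 ->
  a * s + b * (rYZ * gXW - rXZ * gYW) - C * (gYZ * gXW - gXZ * gYW) = 0 ->
  a * t + b * (rYW * gXZ - rXW * gYZ) - C * (gYW * gXZ - gXW * gYZ) = 0 ->
  rYZ * gXW - rXZ * gYW + (rYW * gXZ - rXW * gYZ) = 0.
Proof.
move=> b0 /eqP; rewrite addr_eq0 => /eqP -> E3 E2.
by apply: (mulfI b0); lra.
Qed.

(** * Affine connections in a chart *)

Section Connection.
Context {R : realType} {m : nat} (M : manifold R m) (nabla : connection M).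
Hypothesis nablaP : is_affine_connection nabla.
Variable c : atlas_index M.
Implicit Types (X Y : local_field R m) (f : 'rV[R]_m -> R^o).

Lemma img_open : open (img c).
Proof. exact: chart_img_open. Qed.

Lemma chg_id x : img c x -> chg c c x = x.
Proof. by case=> p cp <-; rewrite /chg /transition chart_mapK. Qed.

Lemma derive_chg_id x v : img c x -> 'D_v (chg c c) x = v.
Proof.
move=> cx; rewrite -[RHS](derive_id x v); apply: near_eq_derive.
by apply: (near_open img_open cx) => y cy; rewrite chg_id.
Qed.

Lemma chg_overlap_id : chg_overlap c c = img c.
Proof. by rewrite /chg_overlap /overlap setIid. Qed.

(** The change of coordinates law from a chart to itself compares fields on the
    domain of the chart only, so it makes the connection local. *)
Lemma nabla_local X Y Y' x : smooth_on (img c) X ->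
  smooth_on (img c) Y -> smooth_on (img c) Y' ->
  (forall y, img c y -> Y y = Y' y) -> img c x ->
  nabla c X Y x = nabla c X Y' x.
Proof.
move=> sX sY sY' YY' cx.
have := nabla_change nablaP sX sY sX sY'.
rewrite /agree chg_overlap_id => H.
have {}H := H _ _ x cx.
rewrite chg_id// derive_chg_id// in H; rewrite H//.
- by move=> y cy; rewrite chg_id// derive_chg_id.
- by move=> y cy; rewrite chg_id// derive_chg_id// YY'.
Qed.

Lemma nabla_eq0 X Y x : smooth_on (img c) X -> smooth_on (img c) Y ->
  (forall y, img c y -> Y y = 0) -> img c x -> nabla c X Y x = 0.
Proof.
move=> sX sY Y0 cx.
(* On the chart Y = 0 Y, and the Leibniz rule differentiates the factor 0. *)
pose z : 'rV[R]_m -> R^o := fun=> 0.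
have sz : smooth_on (img c) z by exact: smooth_cst.
have sZ : smooth_on (img c) (fun y => z y *: Y y).
  exact: (smooth_scale img_open sz sY).
have YZ y : img c y -> Y y = z y *: Y y by move=> /Y0 ->; rewrite scaler0.
rewrite (nabla_local sX sY sZ YZ cx).
rewrite (nabla_leibniz nablaP sz sX sY cx) [z x *: _]scale0r addr0.
by rewrite [X in X *: _](derive_cst (0 : R^o)) scale0r.
Qed.
End Connection.

(** * The curvature of a Levi-Civita connection *)

Section MetricCurvature.
Context {R : realType} {m : nat} (M : manifold R m) (g : pseudo_metric M).
Context (nabla : connection M) (lc : is_levi_civita g nabla).
Variable c : atlas_index M.
Implicit Types (X Y Z W : local_field R m).

Let oc := @img_open _ _ _ c.

(** Differentiating f = g(Z, W) twice with the product rule of the metric, the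
    mixed terms are symmetric in X and Y; what is left of
    X(Yf) - Y(Xf) - [X, Y]f = 0 is the claim. *)
Lemma curv_skew X Y Z W x :
  smooth_on (img c) X -> smooth_on (img c) Y ->
  smooth_on (img c) Z -> smooth_on (img c) W -> img c x ->
  eval_bilin (g c x) (curv nabla c X Y Z x) (W x)
  + eval_bilin (g c x) (Z x) (curv nabla c X Y W x) = 0.
Proof.
move=> sX sY sZ sW cx.
pose G Z W : 'rV[R]_m -> R^o := fun y => eval_bilin (g c y) (Z y) (W y).
have sG Z' W' : smooth_on (img c) Z' -> smooth_on (img c) W' ->
    smooth_on (img c) (G Z' W').
  by apply: smooth_bilin; [exact: oc|exact: metric_smooth].
have sN X' Z' : smooth_on (img c) X' -> smooth_on (img c) Z' ->
    smooth_on (img c) (nabla c X' Z').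
  exact: (nabla_smooth (lc_affine lc)).
have DG X' Z' W' y : smooth_on (img c) X' -> smooth_on (img c) Z' ->
    smooth_on (img c) W' -> img c y ->
    'D_(X' y) (G Z' W') y = G (nabla c X' Z') W' y + G Z' (nabla c X' W') y.
  by move=> *; exact: (lc_metric lc).
have DDG X' Y' : smooth_on (img c) X' -> smooth_on (img c) Y' ->
    'D_(X' x) (fun y => 'D_(Y' y) (G Z W) y : R^o) x =
      G (nabla c X' (nabla c Y' Z)) W x + G (nabla c Y' Z) (nabla c X' W) x
      + (G (nabla c X' Z) (nabla c Y' W) x + G Z (nabla c X' (nabla c Y' W)) x).
  move=> sX' sY'; have sYZ := sN _ _ sY' sZ; have sYW := sN _ _ sY' sW.
  rewrite -(DG _ _ _ _ sX' sYZ sW cx) -(DG _ _ _ _ sX' sZ sYW cx).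
  have d1 : derivable (G (nabla c Y' Z) W) x (X' x).
    exact: (smooth_derivable oc (sG _ _ sYZ sW) cx).
  have d2 : derivable (G Z (nabla c Y' W)) x (X' x).
    exact: (smooth_derivable oc (sG _ _ sZ sYW) cx).
  rewrite -(deriveD d1 d2); apply: near_eq_derive.
  by apply: (near_open oc cx) => y cy; exact: (DG _ _ _ _ sY' sZ sW cy).
have := bracket_derive oc (sG Z W sZ sW) sX sY cx.
rewrite (DDG _ _ sX sY) (DDG _ _ sY sX).
rewrite (DG _ _ _ _ (smooth_bracket oc sX sY) sZ sW cx).
rewrite /G /curv.
have gC u v : eval_bilin (g c x) u v = eval_bilin (g c x) v u.
  exact: eval_bilinC (Defs.metric_sym g cx).
rewrite !(gC (Z x)) !(eval_bilinDl, eval_bilinNl).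
lra.
Qed.
End MetricCurvature.

(** * Flatness implies constant curvature *)

Section ConstantCurvature.
Context {R : realType} {m : nat} (M : manifold R m) (g : pseudo_metric M).
Context (nabla : connection M) (lc : is_levi_civita g nabla).
Variables (c : atlas_index M) (x : 'rV[R]_m) (cx : img c x).
Implicit Types (X Y Z W : local_field R m).

Local Notation gx := (eval_bilin (g c x)).

Let gxC u v : gx u v = gx v u.
Proof. exact: eval_bilinC (Defs.metric_sym g cx). Qed.

(** Valid in every dimension and for every coefficient C of the metric term.
    The unit field T and the vector v orthogonal to it play the roles of e and v
    in [curvature_like_einstein]. *)
Lemma flat_constant_curvature (a b C : R) (T : local_field R m)
    (v : 'rV[R]_m) :
  a != 0 -> b != 0 ->
  (forall X Y Z, smooth_on (img c) X -> smooth_on (img c) Y ->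
    smooth_on (img c) Z ->
    a *: curv nabla c X Y Z x
    + b *: (ric nabla c Y Z x *: X x - ric nabla c X Z x *: Y x)
    - C *: (gx (Y x) (Z x) *: X x - gx (X x) (Z x) *: Y x) = 0) ->
  smooth_on (img c) T -> gx (T x) (T x) = 1 -> v != 0 -> gx v (T x) = 0 ->
  exists K, forall X Y Z, smooth_on (img c) X -> smooth_on (img c) Y ->
    smooth_on (img c) Z ->
    curv nabla c X Y Z x
      = K *: (gx (Y x) (Z x) *: X x - gx (X x) (Z x) *: Y x).
Proof.
move=> a0 b0 flat sT TT v0 vT.
have [w vw] := nondegenerate_pairing (metric_nondegenerate g cx) v0.
pose F := {X : local_field R m | smooth_on (img c) X}.
pose r (Y Z : F) := ric nabla c (sval Y) (sval Z) x.
pose h (Y Z : F) := gx (sval Y x) (sval Z x).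
pose cf (u : 'rV[R]_m) : F := exist _ (fun=> u) (smooth_cst u).
have skew (X Y Z W : F) : r Y Z * h X W - r X Z * h Y W
     + (r Y W * h X Z - r X W * h Y Z) = 0.
  case: X Y Z W => [X sX] [Y sY] [Z sZ] [W sW].
  rewrite /r /h /=.
  have := congr1 (gx^~ (W x)) (flat X Y Z sX sY sZ).
  have := congr1 (gx^~ (Z x)) (flat X Y W sX sY sW).
  have := curv_skew lc sX sY sZ sW cx.
  rewrite (gxC (Z x)).
  have g0 u : gx 0 u = 0 by rewrite gxC eval_bilin0r.
  rewrite /= !(eval_bilinDl, eval_bilinNl, eval_bilinZl) !g0.
  by move=> E1 E2 E3; exact: skew_ricci_relation b0 E1 E3 E2.
pose rho := r (exist _ T sT) (exist _ T sT).
have ricE Y Z (sY : smooth_on (img c) Y) (sZ : smooth_on (img c) Z) :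
    ric nabla c Y Z x = rho * gx (Y x) (Z x).
  exact: (@curvature_like_einstein _ F r h (exist _ T sT) (cf v) (cf w)
    (fun _ _ => gxC _ _) TT vT vw skew (exist _ Y sY) (exist _ Z sZ)).
(* Substituting Ric = rho g, the flatness identity reads
   a R(X, Y)Z = (C - b rho) (g(Y, Z) X - g(X, Z) Y). *)
exists ((C - b * rho) / a) => X Y Z sX sY sZ.
apply: (scalerI a0); rewrite scalerA mulrCA mulfV// mulr1.
have := flat _ _ _ sX sY sZ; rewrite (ricE Y Z sY sZ) (ricE X Z sX sZ).
move=> /eqP; rewrite -addrA addr_eq0 => /eqP ->.
by rewrite opprB scalerBl; congr (_ - _); rewrite !scalerBr !scalerA !mulrA.
Qed.

Variables (K : R).
Hypothesis curvE : forall X Y Z, smooth_on (img c) X -> smooth_on (img c) Y ->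
    smooth_on (img c) Z -> curv nabla c X Y Z x
      = K *: (gx (Y x) (Z x) *: X x - gx (X x) (Z x) *: Y x).

Lemma constant_curvature_ric Y Z :
  smooth_on (img c) Y -> smooth_on (img c) Z ->
  ric nabla c Y Z x = K * (m%:R - 1) * gx (Y x) (Z x).
Proof.
move=> sY sZ; rewrite /ric /mxtrace.
have E i : (\matrix_(i < m, j < m) curv nabla c (coord_field i) Y Z x 0 j) i i
   = K * gx (Y x) (Z x) - K * (Y x 0 i * gx (coord_vec i) (Z x)).
  have sc : smooth_on (img c) (coord_field i : local_field R m).
    exact: smooth_cst.
  rewrite mxE (curvE sc sY sZ) /coord_field !mxE !eqxx/= mulr1 mulrBr.
  by rewrite [X in _ - K * X]mulrC.
rewrite (eq_bigr _ (fun i _ => E i)) sumrB -!mulr_sumr eval_bilin_sum.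
by rewrite sumr_const card_ord -[_ *+ m]mulr_natr; ring.
Qed.

Lemma constant_curvature_scal : scal g nabla c x = K * (m%:R - 1) * m%:R.
Proof.
have E i j : ric nabla c (coord_field i) (coord_field j) x =
    K * (m%:R - 1) * g c x j i.
  rewrite constant_curvature_ric; try exact: smooth_cst.
  by rewrite /coord_field gxC eval_bilin_coord.
rewrite /scal.
under eq_bigr do under eq_bigr do rewrite E mulrCA.
under eq_bigr do rewrite -mulr_sumr.
rewrite -mulr_sumr; congr (_ * _).
have <- : \tr (invmx (g c x) *m g c x) = m%:R :> R.
  by rewrite mulVmx ?mxtrace1//; exact: metric_nondegenerate.
by apply: eq_bigr => i _; rewrite mxE.
Qed.
End ConstantCurvature.

(** * Trans-para-Sasakian manifolds *)

Definition in_chart {R : realType} {m : nat} (M : manifold R m) (f : M -> R)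
  (c : atlas_index M) : 'rV[R]_m -> R^o := fun y => f (point_of c y).

Section TransParaSasakian.
Context {R : realType} {n : nat} (M : manifold R (2 * n).+1).
Context (phi : endo_field M) (xi : vector_field M) (eta : one_form M).
Context (g : pseudo_metric M) (nabla : connection M) (alpha beta : M -> R).
Hypothesis apm : is_almost_paracontact_metric phi xi eta g.
Hypothesis lc : is_levi_civita g nabla.
Hypothesis smooth_alpha : smooth_function alpha.
Hypothesis smooth_beta : smooth_function beta.
Hypothesis tps : is_trans_para_sasakian phi xi eta g nabla alpha beta.
Variable c : atlas_index M.
Implicit Types (X : local_field R (2 * n).+1) (x u v : 'rV[R]_(2 * n).+1).

Let oc : open (img c) := @img_open _ _ _ c.
Let nablaP := lc_affine lc.
Local Notation al := (in_chart alpha c).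
Local Notation be := (in_chart beta c).

Let sal : smooth_on (img c) al. Proof. exact: smooth_alpha. Qed.
Let sbe : smooth_on (img c) be. Proof. exact: smooth_beta. Qed.
Let sxi : smooth_on (img c) (xi c). Proof. exact: vf_smooth. Qed.
Let sphi X : smooth_on (img c) X ->
  smooth_on (img c) (apply_endo (phi c) X).
Proof. by move=> sX; apply: (smooth_mulmx oc sX); exact: endo_smooth. Qed.

(** Compatibility of g and phi at (u, xi), where phi xi = 0. *)
Lemma eta_metric x u : img c x ->
  eval_form (eta c x) u = eval_bilin (g c x) u (xi c x).
Proof.
move=> cx; have := apm_compatible apm cx u (xi c x).
rewrite (apm_phi_xi apm cx) (apm_eta_xi apm cx) eval_bilin0r mulr1.
by move/eqP; rewrite eq_sym addrC subr_eq0 => /eqP.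
Qed.

Lemma metric_xi_xi x : img c x -> eval_bilin (g c x) (xi c x) (xi c x) = 1.
Proof. by move=> cx; rewrite -eta_metric// (apm_eta_xi apm cx). Qed.

(** Differentiate g(xi, xi) = 1. *)
Lemma eta_nabla_xi X x : smooth_on (img c) X -> img c x ->
  eval_form (eta c x) (nabla c X (xi c) x) = 0.
Proof.
move=> sX cx; have := lc_metric lc sX sxi sxi cx.
have -> : 'D_(X x) (fun y => eval_bilin (g c y) (xi c y) (xi c y) : R^o) x = 0.
  rewrite -(derive_cst (1 : R^o) x (X x)); apply: near_eq_derive.
  by apply: (near_open oc cx) => y cy; rewrite metric_xi_xi.
rewrite (eval_bilinC (xi c x) _ (Defs.metric_sym g cx)) -eta_metric//.
lra.
Qed.

(** Since phi xi = 0, the structure identity at Y = xi computes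
    phi (nabla_X xi); applying phi again recovers nabla_X xi, because
    phi^2 = id - eta (x) xi and eta (nabla_X xi) = 0. *)
Lemma nabla_xi X x : smooth_on (img c) X -> img c x ->
  nabla c X (xi c) x = - al x *: (X x *m phi c x)
    + (- be x *: X x + (be x * eval_form (eta c x) (X x)) *: xi c x).
Proof.
move=> sX cx; have := tps sX sxi cx; rewrite /nabla_endo.
have phixi y : img c y -> apply_endo (phi c) (xi c) y = 0.
  by move=> cy; exact: (apm_phi_xi apm cy).
rewrite (nabla_eq0 nablaP sX (sphi sxi) phixi cx) sub0r /apply_endo.
rewrite (apm_phi_xi apm cx) (apm_eta_xi apm cx) eval_bilin0r.
rewrite scale0r add0r !scale1r.
move=> /(congr1 (fun w => w *m phi c x)).
rewrite mulNmx (apm_phi2 apm cx) (eta_nabla_xi sX cx) scale0r subr0.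
rewrite mulmxDl -!scalemxAl mulmxDl -scalemxAl (apm_phi_xi apm cx).
rewrite scaler0 add0r.
rewrite (apm_phi2 apm cx) -/(al x) -/(be x) => /(congr1 -%R).
rewrite opprK => ->.
move: (X x) (X x *m _) (xi c x) (eval_form _ _) => u w z k.
by apply/rowP => j; rewrite !mxE; ring.
Qed.

(** Composing with phi discards all multiples of xi.  Let A denote the
    endomorphism X |-> nabla_X xi.  As nabla_xi xi = 0 and
    [v, xi] = A v - nabla_xi v, one has
    R(v, xi)xi = - nabla_xi (A v) - A (A v) + A (nabla_xi v).  Modulo xi the
    tensor phi is parallel along xi, so nabla_xi (A v) - A (nabla_xi v) is
    - xi(alpha) phi v - xi(beta) v, and
    A^2 v = 2 alpha beta phi v + (alpha^2 + beta^2) v. *)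
Lemma curv_xi_xi v x : img c x ->
  curv nabla c (fun=> v) (xi c) (xi c) x *m phi c x =
    ('D_(xi c x) al x - 2 * al x * be x) *: (v *m phi c x *m phi c x)
    + ('D_(xi c x) be x - al x ^+ 2 - be x ^+ 2) *: (v *m phi c x).
Proof.
move=> cx.
have sv : smooth_on (img c) ((fun=> v) : local_field R (2 * n).+1).
  exact: smooth_cst.
have sU := nabla_smooth nablaP sv sxi.
have sN := nabla_smooth nablaP sxi sxi.
have N0 y : img c y -> nabla c (xi c) (xi c) y = 0.
  move=> cy; rewrite (nabla_xi sxi cy) (apm_phi_xi apm cy) (apm_eta_xi apm cy).
  by rewrite scaler0 add0r mulr1 scaleNr addNr.
have xiphi : xi c x *m phi c x = 0 by exact: (apm_phi_xi apm cx).
pose eta_v : 'rV[R]_(2 * n).+1 -> R^o := fun y => eval_form (eta c y) v.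
have seta : smooth_on (img c) eta_v.
  have se : smooth_on (img c) (eta c) by exact: form_smooth.
  exact: (smooth_coord oc 0 0 (smooth_mulmx oc sv se)).
pose nal : 'rV[R]_(2 * n).+1 -> R^o := fun y => (-1) * al y.
pose nbe : 'rV[R]_(2 * n).+1 -> R^o := fun y => (-1) * be y.
pose bet : 'rV[R]_(2 * n).+1 -> R^o := fun y => be y * eta_v y.
have s1 : smooth_on (img c) ((fun=> -1) : 'rV[R]_(2 * n).+1 -> R^o).
  exact: smooth_cst.
have snal : smooth_on (img c) nal := smooth_mul oc s1 sal.
have snbe : smooth_on (img c) nbe := smooth_mul oc s1 sbe.
have sbet : smooth_on (img c) bet := smooth_mul oc sbe seta.
pose Pv : local_field R (2 * n).+1 := apply_endo (phi c) (fun=> v).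
have sPv : smooth_on (img c) Pv := sphi sv.
have sA := smooth_scale oc snal sPv.
have sB := smooth_scale oc snbe sv.
have sC := smooth_scale oc sbet sxi.
have sBC := smooth_add oc sB sC.
have UE y : img c y -> nabla c (fun=> v) (xi c) y =
    nal y *: Pv y + (nbe y *: v + bet y *: xi c y).
  by move=> cy; rewrite (nabla_xi sv cy) /nal /nbe !mulN1r.
have dN (f : 'rV[R]_(2 * n).+1 -> R^o) : smooth_on (img c) f ->
    'D_(xi c x) (fun y => (-1) * f y : R^o) x = - 'D_(xi c x) f x.
  move=> sf; rewrite -[RHS](deriveN (smooth_derivable oc sf cx)).
  suff -> : (fun y => (-1) * f y : R^o) = - f by [].
  by apply/funext => y; rewrite mulN1r.
have nablaU : nabla c (xi c) (nabla c (fun=> v) (xi c)) x =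
    (- 'D_(xi c x) al x *: (v *m phi c x) + - al x *: nabla c (xi c) Pv x)
    + ((- 'D_(xi c x) be x *: v + - be x *: nabla c (xi c) (fun=> v) x)
       + 'D_(xi c x) bet x *: xi c x).
  rewrite (nabla_local nablaP sxi sU (smooth_add oc sA sBC) UE cx).
  rewrite (nabla_additive_r nablaP sxi sA sBC cx).
  rewrite (nabla_additive_r nablaP sxi sB sC cx).
  rewrite (nabla_leibniz nablaP snal sxi sPv cx).
  rewrite (nabla_leibniz nablaP snbe sxi sv cx).
  rewrite (nabla_leibniz nablaP sbet sxi sxi cx).
  by rewrite (N0 _ cx) scaler0 addr0 (dN _ sal) (dN _ sbe) /nal /nbe !mulN1r.
pose W := nabla c (xi c) (fun=> v) x.
have [k nPv] : exists k, nabla c (xi c) Pv x = W *m phi c x + k *: xi c x.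
  have := tps sxi sv cx; rewrite /nabla_endo -/Pv => /eqP.
  rewrite subr_eq => /eqP ->; rewrite xiphi scaler0 addr0.
  rewrite -scalerDl !scalerA -!scalerDl; eexists; rewrite addrC.
  by rewrite /apply_endo -/W; reflexivity.
have curvx : curv nabla c (fun=> v) (xi c) (xi c) x =
  - nabla c (xi c) (nabla c (fun=> v) (xi c)) x
  - nabla c (bracket (fun=> v) (xi c)) (xi c) x.
  by rewrite /curv (nabla_eq0 nablaP sv sN N0 cx) sub0r.
have sb := smooth_bracket oc sv sxi.
have bE : bracket (fun=> v) (xi c) x = nabla c (fun=> v) (xi c) x - W.
  by rewrite -(lc_torsion_free lc sv sxi cx).
rewrite curvx nablaU nPv (nabla_xi sb cx) bE (UE _ cx) /nal /nbe !mulN1r.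
rewrite /Pv /apply_endo -/W.
move: ('D_(xi c x) bet x) (bet x) (be x * _) => k1 k2 k3.
move: ('D_(xi c x) al x) ('D_(xi c x) be x) (al x) (be x) => da db A B.
rewrite !(mulmxDl, mulNmx, =^~ scalemxAl) xiphi !scaler0 !addr0.
set P := phi c x.
have P3 : v *m P *m P *m P = v *m P.
  by rewrite (apm_phi2 apm cx) (apm_eta_phi apm cx) scale0r subr0.
rewrite !P3 mul0mx !scaler0 !addr0; move: (v *m P) (W *m P) => vP WP.
move: (vP *m P) (WP *m P) => vPP WPP.
by apply/rowP => j; rewrite !mxE; ring.
Qed.

Lemma derive_grad (f : M -> R) x v : smooth_function f -> img c x ->
  'D_v (in_chart f c) x = eval_bilin (g c x) (grad g f c x) v.
Proof.
move=> sf cx; rewrite (smooth_deriveE oc v (sf c) cx).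
rewrite /eval_bilin /grad mulmxKV ?(metric_nondegenerate g cx)// mxE.
by apply: eq_bigr => i _; rewrite !mxE mulrC.
Qed.

(** Apply eta to the gradient hypothesis: eta vanishes on the image of phi, and
    eta (grad beta) = xi(beta).  The factor 2n - 1 is nonzero as n >= 1. *)
Lemma xi_beta_eq0 x : (1 <= n)%N -> img c x ->
  grad g alpha c x *m phi c x = - (2 * n%:R - 1) *: grad g beta c x ->
  'D_(xi c x) be x = 0.
Proof.
move=> n1 cx grads; rewrite (derive_grad _ smooth_beta cx) -eta_metric//.
have := apm_eta_phi apm cx (grad g alpha c x).
rewrite grads eval_formZ => /eqP; rewrite mulf_eq0 oppr_eq0 => /orP[|/eqP//].
have n1R : (1 : R) <= n%:R by rewrite ler1n.
by move=> /eqP; lra.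
Qed.

Lemma phi_eigenvector (eps : R) x : (1 <= n)%N -> eps = 1 \/ eps = -1 ->
  img c x -> exists2 v : 'rV[R]_(2 * n).+1, v != 0 & v *m phi c x = eps *: v.
Proof.
move=> n1 epsE cx.
have : \rank (eigenspace (phi c x) eps :&: kermx (eta c x))%MS = n.
  case: epsE => ->; first exact: apm_eigen_pos apm _ _ cx.
  exact: apm_eigen_neg apm _ _ cx.
move=> rk.
have /rowV0Pn[v] : (eigenspace (phi c x) eps :&: kermx (eta c x))%MS != 0.
  by rewrite -mxrank_eq0 rk -lt0n.
by rewrite sub_capmx => /andP[/eigenspaceP vE _] v0; exists v.
Qed.

(** Testing [curv_xi_xi] on eigenvectors of phi for both eigenvalues separates
    the coefficient of v from that of phi v. *)
Lemma constant_curvature_value (K : R) x : (1 <= n)%N -> img c x ->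
  grad g alpha c x *m phi c x = - (2 * n%:R - 1) *: grad g beta c x ->
  (forall v, curv nabla c (fun=> v) (xi c) (xi c) x =
    K *: (eval_bilin (g c x) (xi c x) (xi c x) *: v
          - eval_bilin (g c x) v (xi c x) *: xi c x)) ->
  K = - (al x ^+ 2 + be x ^+ 2).
Proof.
move=> n1 cx grads curvK; have xb0 := xi_beta_eq0 n1 cx grads.
pose t := 'D_(xi c x) al x - 2 * al x * be x.
have KE eps : eps = 1 \/ eps = -1 ->
    K * eps = t * (eps * eps) - (al x ^+ 2 + be x ^+ 2) * eps.
  move=> epsE; have [v v0 vE] := phi_eigenvector n1 epsE cx.
  have := curv_xi_xi v cx; rewrite curvK metric_xi_xi// scale1r xb0 -/t.
  rewrite -scalemxAl mulmxBl -!scalemxAl (apm_phi_xi apm cx) scaler0 subr0.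
  rewrite !vE -!scalemxAl !vE !scalerA -scalerDl => /eqP.
  rewrite -subr_eq0 -scalerBl scaler_eq0 (negPf v0) orbF subr_eq0 => /eqP ->.
  by ring.
have := KE 1 (or_introl erefl); have := KE (-1) (or_intror erefl); lra.
Qed.
End TransParaSasakian.

Theorem theorem3p12 (R : realType) (n : nat) (n_ge1 : (1 <= n)%N)
    (M : manifold R (2 * n).+1)
    (phi : endo_field M) (xi : vector_field M) (eta : one_form M)
    (g : pseudo_metric M) (nabla : connection M)
    (alpha beta : M -> R) (a b : R) :
  is_almost_paracontact_metric phi xi eta g ->
  is_levi_civita g nabla ->
  smooth_function alpha -> smooth_function beta ->
  is_trans_para_sasakian phi xi eta g nabla alpha beta ->
  (forall (c : atlas_index M) (x : 'rV[R]_(2 * n).+1), img c x ->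
     grad g alpha c x *m phi c x = - (2 * n%:R - 1) *: grad g beta c x) ->
  a != 0 -> b != 0 ->
  pseudo_projectively_flat g nabla a b ->
  is_einstein g nabla /\
  (forall (c : atlas_index M) (x : 'rV[R]_(2 * n).+1), img c x ->
     scal g nabla c x
       = - (2 * n%:R * (2 * n%:R + 1))
         * (alpha (point_of c x) ^+ 2 + beta (point_of c x) ^+ 2)).
Proof.
move=> apm lc sal sbe tps grads a0 b0 flat.
pose k p := - (alpha p ^+ 2 + beta p ^+ 2).
have curvE c x : img c x -> forall X Y Z : local_field R (2 * n).+1,
    smooth_on (img c) X -> smooth_on (img c) Y -> smooth_on (img c) Z ->
    curv nabla c X Y Z x = k (point_of c x) *:
      (eval_bilin (g c x) (Y x) (Z x) *: X x
       - eval_bilin (g c x) (X x) (Z x) *: Y x).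
  move=> cx; have [v v0 vE] := phi_eigenvector apm n_ge1 (or_introl erefl) cx.
  have sxi : smooth_on (img c) (xi c) by exact: vf_smooth.
  have vxi : eval_bilin (g c x) v (xi c x) = 0.
    rewrite -(eta_metric apm v cx).
    by have := apm_eta_phi apm cx v; rewrite vE scale1r.
  have [K KE] := flat_constant_curvature lc cx a0 b0
    (fun X Y Z sX sY sZ => flat c X Y Z sX sY sZ x cx) sxi
    (metric_xi_xi apm cx) v0 vxi.
  suff -> : k (point_of c x) = K by [].
  apply/esym/(constant_curvature_value apm lc sal sbe tps n_ge1 cx (grads c x cx)).
  by move=> w; exact: (KE _ _ _ (smooth_cst w) sxi sxi).
have mE : (2 * n).+1%:R = 2 * n%:R + 1 :> R by rewrite -natr1 natrM.
split.
  exists (fun p => k p * (2 * n%:R)) => c Y Z sY sZ x cx.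
  by rewrite (constant_curvature_ric (curvE c x cx) sY sZ) mE addrK.
move=> c x cx; rewrite (constant_curvature_scal cx (curvE c x cx)) mE /k.
by ring.
Qed.
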